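(* Let $n\in\mathbb{N}$, $n\ge1$, let $L_1,\ldots,L_n$ be bounded lattices and let $L=\bigoplus_{i=1}^nL_i$ be their ordinal sum. Then: (1) $\mathrm{Con}(L)=\{\bigoplus_{i=1}^n\theta_i : \theta_i\in \mathrm{Con}(L_i)\text{ for all }i\in\{1,\ldots,n\}\}\cong\prod_{i=1}^n\mathrm{Con}(L_i)$; (2) for all $\theta_1\in \mathrm{Con}(L_1),\ldots,\theta_n\in \mathrm{Con}(L_n)$, if $\theta=\bigoplus_{i=1}^n\theta_i$, then $|L/\theta|=\left(\sum_{i=1}^n|L_i/\theta_i|\right)-n+1$; (3) $\mathrm{Con}_2(L)=\bigcup_{i=1}^n\{\nabla_{L_1}\oplus\cdots\oplus\nabla_{L_{i-1}}\oplus\theta_i\oplus\nabla_{L_{i+1}}\oplus\cdots\oplus\nabla_{L_n} : \theta_i\in \mathrm{Con}_2(L_i)\}$; (4) $\mathrm{Max}(L)=\bigcup_{i=1}^n\{\nabla_{L_1}\oplus\cdots\oplus\nabla_{L_{i-1}}\oplus\theta_i\oplus\nabla_{L_{i+1}}\oplus\cdots\oplus\nabla_{L_n} : \theta_i\in \mathrm{Max}(L_i)\}$; moreover, $\mathrm{Max}(L)=\mathrm{Con}_2(L)$ iff $\mathrm{Max}(L_i)=\mathrm{Con}_2(L_i)$ for all $i\in\{1,\ldots,n\}$; (5) $\mathrm{Spec}(L)=\bigcup_{i=1}^n\{\nabla_{L_1}\oplus\cdots\oplus\nabla_{L_{i-1}}\oplus\theta_i\oplus\nabla_{L_{i+1}}\oplus\cdots\oplus\nabla_{L_n}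 : \theta_i\in \mathrm{Spec}(L_i)\}$; moreover, $\mathrm{Spec}(L)=\mathrm{Con}_2(L)$ iff $\mathrm{Spec}(L_i)=\mathrm{Con}_2(L_i)$ for all $i\in\{1,\ldots,n\}$; and $\mathrm{Spec}(L)=\mathrm{Max}(L)$ iff $\mathrm{Spec}(L_i)=\mathrm{Max}(L_i)$ for all $i\in\{1,\ldots,n\}$.
   Context: Lattices are non-empty. $\mathrm{Con}(L)$ is the lattice of congruences of $L$ ordered by inclusion, with greatest element $\nabla_L=L^2$. $\mathrm{Con}_2(L)=\{\theta\in \mathrm{Con}(L) : |L/\theta|=2\}$; $\mathrm{Max}(L)$ is the set of maximal elements of $\mathrm{Con}(L)\setminus\{\nabla_L\}$. Since the commutator of congruences of a lattice is the intersection, a congruence $\phi\neq\nabla_L$ is prime iff, for all $\alpha,\beta\in \mathrm{Con}(L)$, $\alpha\cap\beta\subseteq\phi$ implies $\alpha\subseteq\phi$ or $\beta\subseteq\phi$; $\mathrm{Spec}(L)$ is the set of prime congruences of $L$. For lattices $L$ with a greatest element and $M$ with a least element, the ordinal sum $L\oplus M$ is obtained by putting $M$ above $L$ and identifying the greatest element of $L$ with the least element of $M$; call this common element $c$. For $\alpha\in \mathrm{Con}(L)$ and $\beta\in \mathrm{Con}(M)$, $\alpha\oplus\beta$ is the equivalence on $L\oplus M$ whose set of classes is $(L/\alpha\setminus\{c/\alpha\})\cup(M/\beta\setminus\{c/\beta\})\cup\{c/\alpha\cup c/\beta\}$. Finite ordinal sums $\bigoplus_{i=1}^n$ of lattices and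 of congruences are obtained by iterating. *)

(* Defs.v *)
From HB Require Import structures.
From mathcomp Require Import all_boot all_order.
From mathcomp Require Import boolp classical_sets functions cardinality.

Set Implicit Arguments.
Unset Strict Implicit.
Unset Printing Implicit Defensive.

Import Order.TTheory.

Local Open Scope order_scope.
Local Open Scope classical_set_scope.
Local Open Scope card_scope.

(* ** Congruences of a lattice, as subsets of L * L *)

Section Congruences.
Context {d : Order.disp_t} (L : latticeType d).
Implicit Types (theta phi alpha beta : set (L * L)).

Definition is_congruence theta : Prop :=
  [/\ forall x, theta (x, x),
      forall x y, theta (x, y) -> theta (y, x),
      forall x y z, theta (x, y) -> theta (y, z) -> theta (x, z) &
      forall x x' y y', theta (x, x') -> theta (y, y') ->
        theta ((x `&` y)%O, (x' `&` y')%O) /\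
        theta ((x `|` y)%O, (x' `|` y')%O)].

Definition Con : set (set (L * L)) := [set theta | is_congruence theta].

Definition nabla : set (L * L) := [set: L * L].

Definition cclass theta (x : L) : set L := [set y | theta (x, y)].

Definition quot theta : set (set L) := [set cclass theta x | x in [set: L]].

Definition Con2 : set (set (L * L)) :=
  [set theta | Con theta /\ quot theta #= `I_2].

Definition Max : set (set (L * L)) :=
  [set theta | (Con `\ nabla) theta /\
     forall phi, (Con `\ nabla) phi -> theta `<=` phi -> phi = theta].

Definition Spec : set (set (L * L)) :=
  [set phi | (Con `\ nabla) phi /\
     forall alpha beta, Con alpha -> Con beta ->
       alpha `&` beta `<=` phi -> alpha `<=` phi \/ beta `<=` phi].

End Congruences.

Arguments Con {d} L.
Arguments nabla {d} L.
Arguments Con2 {d} L.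
Arguments Max {d} L.
Arguments Spec {d} L.

(* ** Ordinal sums

   The ordinal sum of L (with a greatest element) and M (with a least element)
   is realised as the sublattice of the direct product L * M consisting of the
   pairs (x, \bot) and (\top, y): x in L is identified with (x, \bot), y in M
   with (\top, y), and the two copies meet exactly in the glueing point
   c = (\top, \bot).  The lemmas osum_inl_le, ..., osum_inl_inr below show that
   the induced order is that of the ordinal sum. *)

Section OrdinalSumLattice.
Context {d : Order.disp_t} (L : tLatticeType d) (M : bLatticeType d).

Definition osum_pred : {pred L *prod[d] M} :=
  fun p => (p.1 == \top) || (p.2 == \bot).

Lemma osum_pred_meet : meet_closed osum_pred.
Proof.
move=> [x y] [x' y']; rewrite !unfold_in /=.
move=> /orP[/eqP-> | /eqP->]; last by rewrite meet0x eqxx orbT.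
by move=> /orP[/eqP-> | /eqP->]; rewrite ?meetx0 ?meetxx eqxx ?orbT.
Qed.

Lemma osum_pred_join : join_closed osum_pred.
Proof.
move=> [x y] [x' y']; rewrite !unfold_in /=.
move=> /orP[/eqP-> | /eqP->]; first by rewrite join1x eqxx.
by move=> /orP[/eqP-> | /eqP->]; rewrite ?joinx1 ?joinxx eqxx ?orbT.
Qed.

HB.instance Definition _ :=
  Order.isMeetLatticeClosed.Build _ _ osum_pred osum_pred_meet.
HB.instance Definition _ :=
  Order.isJoinLatticeClosed.Build _ _ osum_pred osum_pred_join.

Record osum := OSum { osum_val :> L *prod[d] M; _ : osum_val \in osum_pred }.

HB.instance Definition _ := [isSub for osum_val].
HB.instance Definition _ := [Choice of osum by <:].
HB.instance Definition _ := [SubChoice_isSubLattice of osum by <: with d].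

Lemma osum_inl_subproof (x : L) : ((x, \bot) : L *prod[d] M) \in osum_pred.
Proof. by rewrite unfold_in /= eqxx orbT. Qed.

Lemma osum_inr_subproof (y : M) : ((\top, y) : L *prod[d] M) \in osum_pred.
Proof. by rewrite unfold_in /= eqxx. Qed.

Definition osum_inl (x : L) : osum := OSum (osum_inl_subproof x).
Definition osum_inr (y : M) : osum := OSum (osum_inr_subproof y).

Lemma osum_glue : osum_inl \top = osum_inr \bot.
Proof. exact: val_inj. Qed.

Lemma osum_cover (p : osum) :
  (exists x, p = osum_inl x) \/ (exists y, p = osum_inr y).
Proof.
case: p => [[x y] /= xyP]; case/orP: (xyP) => /= /eqP E.
  by right; exists y; apply: val_inj; rewrite /= E.
by left; exists x; apply: val_inj; rewrite /= E.
Qed.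

Lemma osum_inl_le x x' : (osum_inl x <= osum_inl x') = (x <= x').
Proof. by rewrite -[LHS]/((x <= x') && (\bot <= \bot)) lexx andbT. Qed.

Lemma osum_inr_le y y' : (osum_inr y <= osum_inr y') = (y <= y').
Proof. by rewrite -[LHS]/((\top <= \top) && (y <= y')) lexx. Qed.

Lemma osum_inl_inr_le x y : osum_inl x <= osum_inr y.
Proof. by rewrite -[_ <= _]/((x <= \top) && (\bot <= y)) lex1 le0x. Qed.

Lemma osum_inl_inr x y : osum_inl x = osum_inr y -> x = \top /\ y = \bot.
Proof. by move=> /(congr1 val)[-> ->]. Qed.

End OrdinalSumLattice.

Section OrdinalSumBounded.
Context {d : Order.disp_t} (L M : tbLatticeType d).

Lemma osum_le0x (p : osum L M) : osum_inl M \bot <= p.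
Proof.
case: (osum_cover p) => [][z ->]; last exact: osum_inl_inr_le.
by rewrite osum_inl_le le0x.
Qed.

Lemma osum_lex1 (p : osum L M) : p <= osum_inr L \top.
Proof.
case: (osum_cover p) => [][z ->]; first exact: osum_inl_inr_le.
by rewrite osum_inr_le lex1.
Qed.

HB.instance Definition _ := Order.hasBottom.Build d (osum L M) osum_le0x.
HB.instance Definition _ := Order.hasTop.Build d (osum L M) osum_lex1.

End OrdinalSumBounded.

(* ** Ordinal sum of congruences, defined through its set of classes *)

Section OrdinalSumCongruences.
Context {d : Order.disp_t} (L : tLatticeType d) (M : bLatticeType d).
Variables (alpha : set (L * L)) (beta : set (M * M)).

Definition csum_classes : set (set (osum L M)) :=
  [set @osum_inl d L M @` A | A in quot alpha `\ cclass alpha \top] `|`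
  [set @osum_inr d L M @` B | B in quot beta `\ cclass beta \bot] `|`
  [set @osum_inl d L M @` cclass alpha \top `|`
       @osum_inr d L M @` cclass beta \bot].

Definition csum : set (osum L M * osum L M) :=
  [set p | exists2 C, csum_classes C & C p.1 /\ C p.2].

End OrdinalSumCongruences.

(* ** Finite ordinal sums of n.+1 lattices and of n.+1 congruences *)

Fixpoint bigosum {d : Order.disp_t} (n : nat) :
    ('I_n.+1 -> tbLatticeType d) -> tbLatticeType d :=
  match n with
  | 0 => fun L => L ord0
  | m.+1 => fun L =>
      osum (L ord0) (bigosum (fun i : 'I_m.+1 => L (lift ord0 i)))
  end.

Fixpoint bigcsum {d : Order.disp_t} (n : nat) :
    forall L : 'I_n.+1 -> tbLatticeType d,
    (forall i, set (L i * L i)) -> set (bigosum L * bigosum L) :=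
  match n with
  | 0 => fun L theta => theta ord0
  | m.+1 => fun L theta =>
      csum (theta ord0) (bigcsum (fun i : 'I_m.+1 => theta (lift ord0 i)))
  end.

(* nabla (+) ... (+) nabla (+) t (+) nabla (+) ... (+) nabla, with t at
   position i *)
Definition csum_at {d : Order.disp_t} (n : nat) (L : 'I_n.+1 -> tbLatticeType d)
    (i : 'I_n.+1) (t : set (L i * L i)) : set (bigosum L * bigosum L) :=
  bigcsum (dfwith (fun j => nabla (L j)) t).

(* ** Isomorphism of ordered sets; between lattices, this is the same as
   isomorphism of lattices *)
Definition order_iso (T U : Type) (A : set T) (leA : T -> T -> Prop)
    (B : set U) (leB : U -> U -> Prop) : Prop :=
  exists f : T -> U, set_bij A B f /\
    forall x y, A x -> A y -> (leA x y <-> leB (f x) (f y)).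

(* ** Disjoint unions, used for sums of cardinals *)
Definition dunion (T U : Type) (A : set T) (B : set U) : set (T + U) :=
  inl @` A `|` inr @` B.

Definition bigdunion (I : Type) (T : I -> Type) (A : forall i, set (T i)) :
    set {i : I & T i} :=
  [set p | A (tag p) (tagged p)].

(* Main.v *)
(* As a sublattice of [\prod_i L_i], the ordinal sum consists of the families
   [y] such that, for [i < j], [y_i = \top] or [y_j = \bot].  In these
   coordinates the ordinal sum of congruences is the coordinatewise relation,
   and every congruence is of this form, because a congruence of [L (+) M] is
   determined by its restrictions to [L] and [M], the two of them meeting at
   the glueing point.  The statements on Max and Spec then only depend on the
   isomorphism of Con(L) with the product of the Con(L_i); those on Con_2 follow
   since the coordinate maps are onto and Con_2 is contained in Max. *)

Require Import Defs.
From mathcomp Require Import all_boot all_order.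
From mathcomp Require Import zify.
From mathcomp Require Import boolp classical_sets functions cardinality.

Set Implicit Arguments.
Unset Strict Implicit.
Unset Printing Implicit Defensive.

Import Order.TTheory.

Local Open Scope classical_set_scope.
Local Open Scope card_scope.

(** * Dependent families over ['I_n.+1], by cases on the first index *)

Section OrdCase.
Context (n : nat) (P : 'I_n.+1 -> Type).
Variables (y0 : P ord0) (y : forall j : 'I_n, P (lift ord0 j)).

Definition ord_case (i : 'I_n.+1) : P i :=
  match unliftP ord0 i with
  | UnliftSome j e => ecast i (P i) (esym e) (y j)
  | UnliftNone e => ecast i (P i) (esym e) y0
  end.

Lemma ord_case0 : ord_case ord0 = y0.
Proof. by rewrite /ord_case; case: unliftP => // e; rewrite eq_axiomK. Qed.

Lemma ord_caseS j : ord_case (lift ord0 j) = y j.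
Proof.
rewrite /ord_case; case: unliftP => [k e|//].
(* Once [k] is replaced by [j], the cast is along a proof of a reflexive equation, which [eq_axiomK]
   removes. *)
have ejk := lift_inj e; case: _ / ejk in e *.
by rewrite eq_axiomK.
Qed.

End OrdCase.

Lemma ord_forall n (P : 'I_n.+1 -> Prop) :
  P ord0 -> (forall j : 'I_n, P (lift ord0 j)) -> forall i, P i.
Proof. by move=> P0 PS i; case: (unliftP ord0 i) => [j ->|->]. Qed.

(** * Congruences of a single lattice *)

Section CongruenceTheory.
Context {d : Order.disp_t} {L : latticeType d}.
Implicit Types theta : set (L * L).

Lemma con_refl theta x : Con L theta -> theta (x, x).
Proof. by case. Qed.

Lemma con_sym theta x y : Con L theta -> theta (x, y) -> theta (y, x).
Proof. by case=> _ + _ _; apply. Qed.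

Lemma con_trans theta y x z :
  Con L theta -> theta (x, y) -> theta (y, z) -> theta (x, z).
Proof. by case=> _ _ + _; apply. Qed.

Lemma con_meet theta x x' y y' : Con L theta ->
  theta (x, x') -> theta (y, y') -> theta ((x `&` y)%O, (x' `&` y')%O).
Proof. by case=> _ _ _ h h1 h2; have [] := h _ _ _ _ h1 h2. Qed.

Lemma con_join theta x x' y y' : Con L theta ->
  theta (x, x') -> theta (y, y') -> theta ((x `|` y)%O, (x' `|` y')%O).
Proof. by case=> _ _ _ h h1 h2; have [] := h _ _ _ _ h1 h2. Qed.

Lemma con_diag : Con L [set p | p.1 = p.2].
Proof. by split=> //= [x y z -> //|x x' y y' -> ->]. Qed.

Lemma cclass_eqP theta x y :
  Con L theta -> cclass theta x = cclass theta y <-> theta (x, y).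
Proof.
move=> ct; split=> [e|xy].
  have : cclass theta y y by exact: con_refl.
  by rewrite -e.
apply/seteqP; split=> z; rewrite /cclass /=; apply: con_trans => //.
exact: con_sym.
Qed.

End CongruenceTheory.

Section BoundedCongruenceTheory.
Context {d : Order.disp_t} {L : tbLatticeType d}.
Implicit Types theta : set (L * L).

(** Meeting [\bot ~ \top] with [z] gives [\bot ~ z]. Properness is thus tested on one pair, which
    every coordinate map preserves. *)
Lemma con_bot_top theta : Con L theta ->
  theta = nabla L <-> theta (\bot%O, \top%O).
Proof.
move=> ct; split=> [-> //|h]; apply/seteqP; split=> // -[x y] _.
suff to_bot z : theta (\bot%O, z).
  by apply: con_trans (to_bot y) => //; apply: con_sym (to_bot x).
have := con_meet ct h (con_refl z ct).
by rewrite meet0x meet1x.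
Qed.

(** Two classes must be those of [\bot] and [\top]. This condition on pairs replaces the counting of
    classes and transfers along coordinate maps. *)
Lemma con2P theta : Con L theta ->
  Con2 L theta <-> ~ theta (\bot%O, \top%O) /\
    forall z, theta (\bot%O, z) \/ theta (z, \top%O).
Proof.
move=> ct; split.
  move=> [_ /card_set_bijP[f [f2 finj fsurj]]].
  have fE x y : f (cclass theta x) = f (cclass theta y) -> theta (x, y).
    move=> e; apply/(cclass_eqP _ _ ct)/finj => //; apply/mem_set; by eexists.
  have f_lt x : (f (cclass theta x) < 2)%N by apply: f2; exists x.
  have nbt : ~ theta (\bot%O, \top%O).
    move=> /(con_bot_top ct) e; move: (fsurj 0 isT) (fsurj 1%N isT).
    move=> [_ [x _ <-] f0] [_ [y _ <-] f1]; move: f0.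
    have -> : cclass theta x = cclass theta y.
      by apply/(cclass_eqP _ _ ct); rewrite e.
    by rewrite f1.
  split=> // z.
  have : f (cclass theta \bot%O) <> f (cclass theta \top%O) by move=> /fE.
  move: (@fE \bot%O z) (@fE z \top%O) (f_lt \bot%O) (f_lt \top%O) (f_lt z).
  (* Of three numbers below 2, those of [\bot] and [\top] differ, so that of [z] equals one of
     them. *)
  do 3![case: (f _) => [|[|//]]] => //=; by auto.
move=> [nbt cov]; split=> //; apply/card_set_bijP.
exists (fun C : set L => if `[< C \bot%O >] then 0%N else 1%N).
split.
- by move=> C _ /=; case: asboolP.
- move=> _ _ /set_mem[x _ <-] /set_mem[y _ <-].
  case: asboolP => xb; case: asboolP => yb // _; apply/(cclass_eqP _ _ ct).
    apply: (con_trans ct xb); exact: con_sym.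
  have toT z : ~ theta (z, \bot%O) -> theta (z, \top%O).
    by move=> nz; case: (cov z) => // /(con_sym ct).
  apply: (con_trans ct (toT _ xb)); apply: con_sym => //; exact: toT.
- move=> [|[|//]] _; rewrite /cclass.
    exists (cclass theta \bot%O); first by exists \bot%O.
    by case: asboolP => // -[]; exact: con_refl.
  exists (cclass theta \top%O); first by exists \top%O.
  by case: asboolP => // /(con_sym ct).
Qed.

(** A pair outside [theta] has one point in the class of [\bot] and the other in that of [\top]; a
    larger [phi] containing it relates [\bot] to [\top]. *)
Lemma max_con2 theta : Con2 L theta -> Max L theta.
Proof.
move=> h; have ct := h.1; have [nbt cov] := (con2P ct).1 h.
split=> [|phi [cp /= np] sub].
  by split=> // e; apply: nbt; rewrite e.
apply/seteqP; split=> // -[x y] xy; apply: contrapT => nxy; apply: np.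
apply/(con_bot_top cp).
case: (cov x) (cov y) => hx [] hy.
- by case: nxy; apply: con_trans hy => //; exact: con_sym.
- exact: (con_trans cp (sub _ hx) (con_trans cp xy (sub _ hy))).
- exact: (con_trans cp (sub _ hy) (con_trans cp (con_sym cp xy) (sub _ hx))).
- by case: nxy; apply: (con_trans ct hx); exact: con_sym.
Qed.

End BoundedCongruenceTheory.

(** * Congruences of a binary ordinal sum *)

Section OsumCongruences.
Context {d : Order.disp_t} (L : tLatticeType d) (M : bLatticeType d).
Implicit Types (alpha : set (L * L)) (beta : set (M * M)).
Implicit Types (p q : osum L M).

(** Passes from classes to coordinates: points of one side share a coordinate, and points of
    opposite sides can only be related inside the glued class. *)
Lemma csumP alpha beta p q : Con L alpha -> Con M beta ->
  csum alpha beta (p, q) <-> alpha ((osum_val p).1, (osum_val q).1) /\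
    beta ((osum_val p).2, (osum_val q).2).
Proof.
move=> ca cb; split.
  move=> [C [[[_ [[x _ <-] _] <-]|[_ [[x _ <-] _] <-]]|->]] /= [].
  - move=> [u xu <-] [v xv <-] /=; split; last exact: con_refl.
    by apply: con_trans xv => //; exact: con_sym.
  - move=> [u xu <-] [v xv <-] /=; split; first exact: con_refl.
    by apply: con_trans xv => //; exact: con_sym.
  - have caT u v : cclass alpha \top%O u -> cclass alpha \top%O v -> alpha (u, v).
      by move=> /(con_sym ca) h /(con_trans ca h).
    have cbB u v : cclass beta \bot%O u -> cclass beta \bot%O v -> beta (u, v).
      by move=> /(con_sym cb) h /(con_trans cb h).
    have rT : cclass alpha \top%O \top%O by exact: con_refl.
    have rB : cclass beta \bot%O \bot%O by exact: con_refl.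
    by move=> [] [u hu <-] [] [v hv <-] /=; split; auto.
move=> [a b].
have inner_l x y : alpha (x, y) ->
    csum alpha beta (@osum_inl d L M x, @osum_inl d L M y).
  move=> xy; have xx : cclass alpha x x by exact: con_refl.
  (* The class of [\top] is excluded from the first family of classes; there the glued class is the
     witness. *)
  have [e|ne] := pselect (cclass alpha x = cclass alpha \top%O).
    by eexists; [by right|rewrite -e; split; left; [exists x|exists y]].
  eexists; first by left; left; exists (cclass alpha x) => //; split=> //; exists x.
  by split; [exists x|exists y].
have inner_r x y : beta (x, y) ->
    csum alpha beta (@osum_inr d L M x, @osum_inr d L M y).
  move=> xy; have xx : cclass beta x x by exact: con_refl.
  have [e|ne] := pselect (cclass beta x = cclass beta \bot%O).
    by eexists; [by right|rewrite -e; split; right; [exists x|exists y]].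
  eexists; first by left; right; exists (cclass beta x) => //; split=> //; exists x.
  by split; [exists x|exists y].
case: (osum_cover p) (osum_cover q) a b => [][x ->] [][y ->] /= a b.
- exact: inner_l.
- eexists; first by right.
  by split; [left; exists x => //; exact: con_sym|right; exists y].
- eexists; first by right.
  by split; [right; exists x => //; exact: con_sym|left; exists y].
- exact: inner_r.
Qed.

Lemma con_csum alpha beta :
  Con L alpha -> Con M beta -> Con (osum L M) (csum alpha beta).
Proof.
move=> ca cb; split.
- by move=> p; apply/csumP => //; split; exact: con_refl.
- by move=> p q /csumP-/(_ ca cb)[h1 h2]; apply/csumP => //; split; exact: con_sym.
- move=> p q r /csumP-/(_ ca cb)[h1 h2] /csumP-/(_ ca cb)[h3 h4].
  by apply/csumP => //; split; [apply: con_trans h3|apply: con_trans h4].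
- move=> p p' q q' /csumP-/(_ ca cb)[h1 h2] /csumP-/(_ ca cb)[h3 h4].
  split; apply/csumP => //; split; (exact: con_meet || exact: con_join).
Qed.

(** The components are the restrictions of [phi] to the two sides. *)
Lemma con_osum_csum (phi : set (osum L M * osum L M)) : Con _ phi ->
  exists alpha beta, [/\ Con L alpha, Con M beta & phi = csum alpha beta].
Proof.
move=> cp.
pose inl := @osum_inl d L M; pose inr := @osum_inr d L M.
have inlI x y : inl (x `&` y)%O = (inl x `&` inl y)%O.
  by apply: val_inj; congr (_, _); rewrite meetxx.
have inlU x y : inl (x `|` y)%O = (inl x `|` inl y)%O.
  by apply: val_inj; congr (_, _); rewrite joinxx.
have inrI x y : inr (x `&` y)%O = (inr x `&` inr y)%O.
  by apply: val_inj; congr (_, _); rewrite meetxx.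
have inrU x y : inr (x `|` y)%O = (inr x `|` inr y)%O.
  by apply: val_inj; congr (_, _); rewrite joinxx.
pose alpha := [set xy : L * L | phi (inl xy.1, inl xy.2)].
pose beta := [set xy : M * M | phi (inr xy.1, inr xy.2)].
have ca : Con L alpha.
  split=> [x|x y|x y z|x x' y y'].
  - exact: (con_refl (inl x) cp).
  - exact: (con_sym cp).
  - exact: (con_trans cp).
  - rewrite /alpha /= !(inlI, inlU) => h h'.
    by split; [exact: con_meet|exact: con_join].
have cb : Con M beta.
  split=> [x|x y|x y z|x x' y y'].
  - exact: (con_refl (inr x) cp).
  - exact: (con_sym cp).
  - exact: (con_trans cp).
  - rewrite /beta /= !(inrI, inrU) => h h'.
    by split; [exact: con_meet|exact: con_join].
(* The coordinates of [p] are its meet and its join with the glueing point, so [phi] passes to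
   them. *)
have inl1 p : inl (osum_val p).1 = (p `&` inl \top)%O.
  apply: val_inj; congr (_, _); rewrite /= ?meetx1 ?meetx0 //.
have inr0 p : inr (osum_val p).2 = (p `|` inr \bot)%O.
  apply: val_inj; congr (_, _); rewrite /= ?joinx1 ?joinx0 //.
exists alpha, beta; split=> //; apply/seteqP; split=> -[p q].
  move=> pq; apply/csumP => //; rewrite /alpha /beta /= !inl1 !inr0.
  by split; [apply: con_meet|apply: con_join]; rewrite //; exact: con_refl.
move=> /csumP-/(_ ca cb)[]; rewrite /alpha /beta /=.
(* Points of opposite sides are linked by transitivity through the glueing point. *)
case: (osum_cover p) (osum_cover q) => [][x ->] [][y ->] //=;
  rewrite -/(inl _) -/(inr _) /inl osum_glue -/(inr _).
- exact: con_trans.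
- by move=> h1 h2; apply: con_trans h2 h1.
Qed.

End OsumCongruences.

(** * Coordinates on a finite ordinal sum *)

Fixpoint bigproj {d : Order.disp_t} (n : nat) :
    forall L : 'I_n.+1 -> tbLatticeType d, bigosum L -> forall i, L i :=
  match n with
  | 0 => fun L p => ord_case p (fun j : 'I_0 => False_rect _ (notF (ltn_ord j)))
  | m.+1 => fun L p => ord_case (osum_val p).1 (bigproj (osum_val p).2)
  end.

Section BigProjections.
Context {d : Order.disp_t}.

Lemma bigproj_ord1 (L : 'I_1 -> tbLatticeType d) (p : bigosum L) :
  bigproj p ord0 = p.
Proof. exact: ord_case0. Qed.

Lemma bigproj0 n (L : 'I_n.+2 -> tbLatticeType d) (p : bigosum L) :
  bigproj p ord0 = (osum_val p).1.
Proof. exact: ord_case0. Qed.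

Lemma bigprojS n (L : 'I_n.+2 -> tbLatticeType d) (p : bigosum L) j :
  bigproj p (lift ord0 j) = bigproj (osum_val p).2 j.
Proof. exact: ord_caseS. Qed.

Lemma bigproj_bot n (L : 'I_n.+1 -> tbLatticeType d) i :
  bigproj (\bot%O : bigosum L) i = \bot%O.
Proof.
elim: n L i => [|n IH] L; apply: ord_forall => [|j].
- exact: bigproj_ord1.
- by case: (ltn_ord j).
- by rewrite bigproj0.
- by rewrite bigprojS IH.
Qed.

Lemma bigproj_top n (L : 'I_n.+1 -> tbLatticeType d) i :
  bigproj (\top%O : bigosum L) i = \top%O.
Proof.
elim: n L i => [|n IH] L; apply: ord_forall => [|j].
- exact: bigproj_ord1.
- by case: (ltn_ord j).
- by rewrite bigproj0.
- by rewrite bigprojS IH.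
Qed.

(** On the right side of the binary sum the first coordinate is [\top]; on the left side the
    remaining point is [\bot], and so are all its coordinates. *)
Lemma bigproj_chain n (L : 'I_n.+1 -> tbLatticeType d) (p : bigosum L)
    (i j : 'I_n.+1) :
  (i < j)%N -> bigproj p i = \top%O \/ bigproj p j = \bot%O.
Proof.
elim: n L p i j => [|n IH] L p i j; first by rewrite !ord1.
case: (unliftP ord0 i) (unliftP ord0 j) => [i' ->|->] [j' ->|->] //.
  by rewrite !bigprojS => ij; exact: IH.
move=> _; rewrite bigproj0 bigprojS.
case: (osum_cover p) => [][y ->] /=; last by left.
by right; exact: bigproj_bot.
Qed.

(** Converse of [bigproj_chain]. If [y ord0] is [\top], the point goes to the right side; otherwise
    all later coordinates are forced to be [\bot]. *)
Lemma bigproj_surj n (L : 'I_n.+1 -> tbLatticeType d) (y : forall i, L i) :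
  (forall i j : 'I_n.+1, (i < j)%N -> y i = \top%O \/ y j = \bot%O) ->
  exists p : bigosum L, forall i, bigproj p i = y i.
Proof.
elim: n L y => [|n IH] L y chain.
  exists (y ord0); apply: ord_forall => [|j]; first exact: bigproj_ord1.
  by case: (ltn_ord j).
have [|q qE] := IH _ (fun j => y (lift ord0 j)).
  by move=> i j ij; apply: chain.
have [y0|y0] := pselect (y ord0 = \top%O).
  exists (osum_inr (L ord0) q); apply: ord_forall => [|j].
    by rewrite bigproj0.
  by rewrite bigprojS.
exists (osum_inl (bigosum (fun j => L (lift ord0 j))) (y ord0)).
apply: ord_forall => [|j]; first by rewrite bigproj0.
by rewrite bigprojS bigproj_bot; case: (chain ord0 (lift ord0 j)).
Qed.

(** Both claims go through one induction, since [csumP] requires the sum over the tail to be a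
    congruence. *)
Lemma bigcsumP n (L : 'I_n.+1 -> tbLatticeType d)
    (theta : forall i, set (L i * L i)) : (forall i, Con (L i) (theta i)) ->
  Con (bigosum L) (bigcsum theta) /\
  forall p q, bigcsum theta (p, q) <->
    forall i, theta i (bigproj p i, bigproj q i).
Proof.
elim: n L theta => [|n IH] L theta ct.
  split=> [|p q]; first exact: ct.
  split=> [pq|/(_ ord0)]; last by rewrite !bigproj_ord1.
  apply: ord_forall => [|j]; first by rewrite !bigproj_ord1.
  by case: (ltn_ord j).
have [cS bE] := IH _ (fun j => theta (lift ord0 j)) (fun j => ct _).
split=> [|p q]; first exact: (con_csum (ct ord0) cS).
split=> [/csumP-/(_ (ct _) cS)[h0 /bE hS]|h].
  by apply: ord_forall => [|j]; rewrite ?bigproj0 ?bigprojS.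
apply/(csumP _ _ (ct ord0) cS); split.
  by have := h ord0; rewrite !bigproj0.
by apply/bE => j; have := h (lift ord0 j); rewrite !bigprojS.
Qed.

Lemma con_bigosum n (L : 'I_n.+1 -> tbLatticeType d) phi :
  Con (bigosum L) phi ->
  exists2 theta : forall i, set (L i * L i),
    forall i, Con (L i) (theta i) & phi = bigcsum theta.
Proof.
elim: n L phi => [|n IH] L phi cp.
  pose theta := @ord_case 0 (fun i => set (L i * L i)) phi
    (fun j => False_rect _ (notF (ltn_ord j))).
  exists theta; last by rewrite /= /theta ord_case0.
  by apply: ord_forall => [|j]; [rewrite /theta ord_case0|case: (ltn_ord j)].
have [alpha [_ [ca /IH[beta cb ->] ->]]] := con_osum_csum cp.
exists (@ord_case _ (fun i => set (L i * L i)) alpha beta).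
  by apply: ord_forall => [|j]; rewrite ?ord_case0 ?ord_caseS.
rewrite /= ord_case0; congr (csum _ (bigcsum _)).
by apply: functional_extensionality_dep => j; rewrite ord_caseS.
Qed.

End BigProjections.

(** * Copies of the summands and the isomorphism with the product *)

Section BigOrdinalSum.
Context {d : Order.disp_t} (n : nat) (L : 'I_n.+1 -> tbLatticeType d).
Implicit Types (theta phi : forall i, set (L i * L i)) (p q : bigosum L).
Local Notation ConF theta := (forall i, Con (L i) (theta i)).

Lemma con_bigcsum theta : ConF theta -> Con (bigosum L) (bigcsum theta).
Proof. by move=> /bigcsumP[]. Qed.

Lemma bigcsumE theta p q : ConF theta -> bigcsum theta (p, q) <->
  forall i, theta i (bigproj p i, bigproj q i).
Proof. by move=> /bigcsumP[]. Qed.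

(** The copy of [x] in the sum. The chain condition holds because [j < k] gives [j < i] or
    [i < k]. *)
Lemma bigproj_at i x : exists p, bigproj p i = x /\
  forall j, j != i -> bigproj p j = if (j < i)%N then \top%O else \bot%O.
Proof.
have [|p pE] := @bigproj_surj _ _ L
    (dfwith (fun j : 'I_n.+1 => if (j < i)%N then \top%O else \bot%O) x).
  move=> j k jk; case: (eqVneq i j) => [eij|nij].
    by right; case: _ / eij jk => jk; rewrite dfwith_out ?neq_ltn ?jk ?ik//= ltnNge ltnW.
  rewrite dfwith_out//; case: ltnP => ji; first by left.
  have ik := leq_ltn_trans ji jk; right.
  by rewrite dfwith_out ?neq_ltn ?jk ?ik//= ltnNge ltnW.
exists p; rewrite pE dfwith_in; split=> // j ji.
by rewrite pE dfwith_out // eq_sym.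
Qed.

Definition biginj i x : bigosum L := sval (cid (@bigproj_at i x)).

Lemma biginjK i x : bigproj (biginj x) i = x.
Proof. by rewrite /biginj; case: cid => p []. Qed.

Lemma bigproj_inj i j x : j != i ->
  bigproj (@biginj i x) j = if (j < i)%N then \top%O else \bot%O.
Proof. by move=> ji; rewrite /biginj; case: cid => p /= [_ h]; exact: h. Qed.

(** Two copies from the same summand agree in all other coordinates, so restricting to the copy of
    [L i] recovers [theta i]. *)
Lemma bigcsum_inj theta i x y : ConF theta ->
  bigcsum theta (@biginj i x, @biginj i y) <-> theta i (x, y).
Proof.
move=> ct; rewrite bigcsumE//; split=> [/(_ i)|h j]; first by rewrite !biginjK.
case: (eqVneq i j) => [e|ij]; first by case: _ / e; rewrite !biginjK.
by rewrite !bigproj_inj 1?eq_sym//; exact: con_refl.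
Qed.

Lemma bigcsum_sub theta phi : ConF theta -> ConF phi ->
  bigcsum theta `<=` bigcsum phi <-> forall i, theta i `<=` phi i.
Proof.
move=> ct cp; split=> [sub i [x y] /(bigcsum_inj x y ct) h|sub [p q]].
  by apply/(bigcsum_inj x y cp); exact: sub.
by rewrite !bigcsumE// => h i; exact: sub.
Qed.

Lemma con_bigcsum_image :
  Con (bigosum L) = [set bigcsum theta | theta in [set theta | ConF theta]].
Proof.
apply/seteqP; split=> [phi /con_bigosum[theta ct ->]|_ [theta ct <-]].
  by exists theta.
exact: con_bigcsum.
Qed.

(** The isomorphism restricts a congruence to the copies of the summands; by [bigcsum_inj] it
    inverts [bigcsum]. *)
Lemma con_bigosum_iso :
  order_iso (Con (bigosum L)) (fun alpha beta => alpha `<=` beta)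
    [set theta | ConF theta]
    (fun theta phi => forall i, theta i `<=` phi i).
Proof.
pose f (phi : set (bigosum L * bigosum L)) i :=
  [set xy : L i * L i | phi (biginj xy.1, biginj xy.2)].
have fK theta : ConF theta -> f (bigcsum theta) = theta.
  move=> ct; apply: functional_extensionality_dep => i.
  by apply/seteqP; split=> -[x y] /=; rewrite /f /= bigcsum_inj.
exists f; split; first split.
- by move=> _ /con_bigosum[theta ct ->]; rewrite fK.
- move=> _ _ /set_mem/con_bigosum[theta ct ->] /set_mem/con_bigosum[phi cp ->].
  by rewrite !fK// => ->.
- by move=> theta ct; exists (bigcsum theta); [exact: con_bigcsum|exact: fK].
- move=> _ _ /con_bigosum[theta ct ->] /con_bigosum[phi cp ->].
  by rewrite !fK// bigcsum_sub.
Qed.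

(** * Sums with [nabla] at all positions but one; maximal, two-class and prime congruences *)

Lemma conF_dfwith theta i t : ConF theta -> Con (L i) t ->
  ConF (dfwith theta t).
Proof. by move=> ct ctt j; case: dfwithP. Qed.

Lemma con_csum_at i t : Con (L i) t -> Con (bigosum L) (csum_at t).
Proof. by move=> ct; apply/con_bigcsum/conF_dfwith. Qed.

Lemma csum_atP i t p q : Con (L i) t ->
  csum_at t (p, q) <-> t (bigproj p i, bigproj q i).
Proof.
move=> ct; rewrite /csum_at bigcsumE; last exact: conF_dfwith.
split=> [/(_ i)|h j]; first by rewrite dfwith_in.
by case: dfwithP.
Qed.

Lemma bigcsum_sub_csum_at theta i t : ConF theta -> Con (L i) t ->
  bigcsum theta `<=` csum_at t <-> theta i `<=` t.
Proof.
move=> ct ctt; rewrite /csum_at bigcsum_sub//; last exact: conF_dfwith.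
split=> [/(_ i)|h j]; first by rewrite dfwith_in.
by case: dfwithP.
Qed.

Lemma csum_at_sub i t u : Con (L i) t -> Con (L i) u ->
  csum_at t `<=` csum_at u <-> t `<=` u.
Proof.
move=> ct cu; rewrite bigcsum_sub_csum_at ?dfwith_in//.
exact: conF_dfwith.
Qed.

Lemma csum_at_inj i t u : Con (L i) t -> Con (L i) u ->
  csum_at t = csum_at u -> t = u.
Proof. by move=> ct cu e; apply/seteqP; split; apply/csum_at_sub => //; rewrite e. Qed.

Lemma bigcsum_nabla theta : ConF theta ->
  bigcsum theta = nabla (bigosum L) <-> forall i, theta i = nabla (L i).
Proof.
move=> ct; rewrite con_bot_top; last exact: con_bigcsum.
rewrite bigcsumE//; split=> h i; have := h i.
  by rewrite bigproj_bot bigproj_top con_bot_top.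
by rewrite bigproj_bot bigproj_top con_bot_top.
Qed.

Lemma csum_at_nabla i t : Con (L i) t ->
  csum_at t = nabla (bigosum L) <-> t = nabla (L i).
Proof.
move=> ct; rewrite con_bot_top; last exact: con_csum_at.
by rewrite csum_atP// bigproj_bot bigproj_top -con_bot_top.
Qed.

Lemma bigcsum_proper theta : ConF theta ->
  bigcsum theta <> nabla (bigosum L) -> exists i, theta i <> nabla (L i).
Proof. by move=> ct /(contra_not (bigcsum_nabla ct).2)/existsNP. Qed.

(** A proper sum has a proper component [theta i] and lies below the proper congruence
    [csum_at (theta i)], so a maximal one equals it. Conversely, above [csum_at t] only the
    component at [i] can vary. *)
Lemma max_bigosum : Max (bigosum L) =
  \bigcup_(i in [set: 'I_n.+1]) [set csum_at t | t in Max (L i)].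
Proof.
apply/seteqP; split.
  move=> _ [[/con_bigosum[theta ct ->] np] maxt].
  have [i npi] := bigcsum_proper ct np.
  have eti : csum_at (theta i) = bigcsum theta.
    apply: maxt; last exact/bigcsum_sub_csum_at.
    by split; [exact: con_csum_at|move=> /csum_at_nabla-/(_ (ct i))].
  exists i => //; exists (theta i) => //; split=> // phi [cp npp] sub.
  apply: csum_at_inj => //; rewrite eti; apply: maxt.
    by split; [exact: con_csum_at|move=> /csum_at_nabla-/(_ cp)].
  by rewrite -eti; exact/csum_at_sub.
move=> _ [i _ [t [[ct npt] maxt] <-]]; split.
  by split; [exact: con_csum_at|move=> /csum_at_nabla-/(_ ct)].
move=> _ [/con_bigosum[theta cth ->] np].
rewrite {1}/csum_at bigcsum_sub//; last exact: conF_dfwith.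
move=> sub.
have thN j : j != i -> theta j = nabla (L j).
  move=> ji; apply/seteqP; split=> //.
  by have := sub j; rewrite dfwith_out// eq_sym.
have ti : theta i = t.
  apply: maxt; last by have := sub i; rewrite dfwith_in.
  split=> // tN; apply: np; apply/bigcsum_nabla => // j.
  by case: (eqVneq j i) => [->|/thN].
congr bigcsum; apply: functional_extensionality_dep => j.
by case: dfwithP => // {}j; rewrite eq_sym => /thN.
Qed.

(** The criterion [con2P] is read in coordinate [i], which is onto by [biginj]. *)
Lemma con2_csum_at i t : Con (L i) t ->
  Con2 (bigosum L) (csum_at t) <-> Con2 (L i) t.
Proof.
move=> ct; rewrite con2P; last exact: con_csum_at.
rewrite con2P// csum_atP// bigproj_bot bigproj_top.
split=> -[nbt cov]; split=> // z.
  by have := cov (biginj z); rewrite !csum_atP// bigproj_bot bigproj_top biginjK.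
by rewrite !csum_atP// bigproj_bot bigproj_top.
Qed.

(** By [max_con2], the description of the maximal congruences already gives the shape
    [csum_at t]. *)
Lemma con2_bigosum : Con2 (bigosum L) =
  \bigcup_(i in [set: 'I_n.+1]) [set csum_at t | t in Con2 (L i)].
Proof.
apply/seteqP; split=> [phi c2|_ [i _ [t c2 <-]]]; last first.
  by apply/con2_csum_at => //; exact: c2.1.
move: (max_con2 c2) (c2); rewrite max_bigosum => -[i _ [t mt <-]].
by move=> /con2_csum_at-/(_ mt.1.1) c2t; exists i => //; exists t.
Qed.

(* A prime congruence contains [csum_at 0] at position [i], or the sum of
   [nabla] at [i] and of [0] elsewhere, as these two intersect in [0]. *)
Lemma spec_bigosum : Spec (bigosum L) =
  \bigcup_(i in [set: 'I_n.+1]) [set csum_at t | t in Spec (L i)].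
Proof.
apply/seteqP; split.
  move=> _ [[/con_bigosum[theta ct ->] np] primet].
  have [i npi] := bigcsum_proper ct np.
  pose diag j := [set p : L j * L j | p.1 = p.2].
  pose beta := dfwith diag (nabla (L i)).
  have cbeta : ConF beta by apply: conF_dfwith => // j; exact: con_diag.
  have cd : Con (L i) (diag i) by exact: con_diag.
  have thN j : j != i -> theta j = nabla (L j).
    move=> ji; apply/seteqP; split=> //.
    case: (primet (csum_at (diag i)) (bigcsum beta)).
    - exact: con_csum_at.
    - exact: con_bigcsum.
    - move=> [p q] [/(csum_atP _ _ cd) /= pqi /(bigcsumE _ _ cbeta) pq].
      apply/bigcsumE => // k; case: (eqVneq k i) => [->|ki].
        by rewrite (pqi : bigproj p i = bigproj q i); exact: con_refl.
      have := pq k; rewrite /beta dfwith_out 1?eq_sym// /diag /= => ->.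
      exact: con_refl.
    (* If the first congruence is contained, its component at [j] gives that [theta j] is
       [nabla]. *)
    - move=> /bigcsum_sub sub; have := sub _ ct j.
      by rewrite dfwith_out 1?eq_sym//; apply; exact: conF_dfwith.
    (* If the second is contained, [theta i] is [nabla], against the choice of [i]. *)
    - move=> /(bigcsum_sub cbeta ct)/(_ i); rewrite /beta dfwith_in => iN.
      by case: npi; apply/seteqP; split.
  have eti : bigcsum theta = csum_at (theta i).
    congr bigcsum; apply: functional_extensionality_dep => j.
    by case: dfwithP => // {}j; rewrite eq_sym => /thN.
  exists i => //; exists (theta i) => //; split=> // a b ca cb ab.
  have := primet _ _ (con_csum_at ca) (con_csum_at cb); rewrite eti.
  rewrite !csum_at_sub//; apply=> -[p q] [].
  by rewrite !csum_atP// => ha hb; exact: ab.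
move=> _ [i _ [t [[ct npt] primet] <-]]; split.
  by split; [exact: con_csum_at|move=> /csum_at_nabla-/(_ ct)].
move=> _ _ /con_bigosum[a ca ->] /con_bigosum[b cb ->] ab.
(* Only the components at [i] matter, so primeness of [t] applies to [a i] and [b i], the
   intersection being tested on the copy of [L i]. *)
rewrite !bigcsum_sub_csum_at//; apply: primet => // -[x y] [axy bxy].
have : csum_at t (@biginj i x, @biginj i y).
  by apply: ab; split; apply/bigcsum_inj.
by rewrite csum_atP// !biginjK.
Qed.

(** For proper [t], [csum_at t] determines both the position and [t], whereas [nabla] would arise at
    every position. *)
Lemma bigcup_csum_at_eq (A B : forall i, set (set (L i * L i))) :
  (forall i, A i `<=` Con (L i) `\ nabla (L i)) ->
  (forall i, B i `<=` Con (L i) `\ nabla (L i)) ->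
  \bigcup_(i in [set: 'I_n.+1]) [set csum_at t | t in A i] =
    \bigcup_(i in [set: 'I_n.+1]) [set csum_at t | t in B i] <->
  forall i, A i = B i.
Proof.
move=> hA hB; split=> [e i|e]; last first.
  by congr bigcup; apply/funext => i; rewrite e.
suff sub (C D : forall i, set (set (L i * L i))) j :
    (forall i, C i `<=` Con (L i) `\ nabla (L i)) ->
    (forall i, D i `<=` Con (L i) `\ nabla (L i)) ->
    \bigcup_(i in [set: 'I_n.+1]) [set csum_at t | t in C i] `<=`
      \bigcup_(i in [set: 'I_n.+1]) [set csum_at t | t in D i] ->
    C j `<=` D j.
  by apply/seteqP; split; apply: sub => //; rewrite e.
move=> hC hD sub t Ct; have [ct npt] := hC _ _ Ct.
have [k _ [u Du eut]] :=
  sub (csum_at t) (ex_intro2 _ _ j I (ex_intro2 _ _ t Ct erefl)).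
have [cu npu] := hD _ _ Du.
(* If the positions differed, the copies of [\bot] and [\top] of [L k] would agree in coordinate
   [j], making [u] equal to [nabla]. *)
have ejk : j = k.
  case: (eqVneq j k) => [//|jk]; case: npu; apply/con_bot_top => //.
  have : csum_at t (biginj (\bot%O : L k), biginj (\top%O : L k)).
    by rewrite csum_atP// !bigproj_inj//; exact: con_refl.
  by rewrite -eut csum_atP// !biginjK.
case: _ / ejk in u Du eut cu npu *.
by rewrite (csum_at_inj ct cu (esym eut)).
Qed.

(** * Counting the classes of a sum *)

(** The left side depends on the class of [x] only, so it can define a map on quotients. *)
Lemma cclass_biginj theta i x : ConF theta ->
  [set q | exists2 y, cclass (theta i) x y & bigcsum theta (biginj y, q)] =
  cclass (bigcsum theta) (biginj x).
Proof.
move=> ct; have cb := con_bigcsum ct; apply/seteqP; split=> q; rewrite /cclass /=.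
  by move=> [y xy yq]; apply: (con_trans cb _ yq); exact/bigcsum_inj.
by move=> xq; exists x => //; exact: (con_refl x (ct i)).
Qed.

(** Copies from the lower summand have coordinate [\bot] at [j]. *)
Lemma bigcsum_inj_lt theta (i j : 'I_n.+1) x y : ConF theta -> (i < j)%N ->
  bigcsum theta (@biginj i x, @biginj j y) -> theta j (\bot%O, y).
Proof.
move=> ct ij /(bigcsumE _ _ ct)/(_ j); rewrite biginjK bigproj_inj.
  by rewrite ltnNge ltnW.
by rewrite neq_ltn ij orbT.
Qed.

(** Take the last [i] at which the coordinate of [q] is not related to [\bot], or [ord0] if there is
    none. Earlier coordinates are [\top] by [bigproj_chain], later ones are related to [\bot]. *)
Lemma bigcsum_decomp theta q : ConF theta ->
  exists i x, bigcsum theta (@biginj i x, q) /\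
    (i = ord0 \/ ~ theta i (\bot%O, x)).
Proof.
move=> ct; pose P i := (i == ord0) || ~~ `[< theta i (\bot%O, bigproj q i) >].
have P0 : P ord0 by [].
case: (arg_maxnP (fun i : 'I_n.+1 => i : nat) P0) => i Pi imax.
have nbi : i = ord0 \/ ~ theta i (\bot%O, bigproj q i).
  by case/orP: Pi => [/eqP ->|/asboolPn]; [left|right].
exists i, (bigproj q i); split=> //; apply/bigcsumE => // j.
case: (eqVneq i j) => [e|ij].
  by case: _ / e; rewrite biginjK; exact: con_refl.
rewrite bigproj_inj 1?eq_sym//; case: ltnP => ji.
  case: (bigproj_chain q ji) => [->|e]; first exact: con_refl.
  case: nbi => [i0|[]]; first by rewrite i0 in ji.
  by rewrite e; exact: (con_refl _ (ct i)).
have : ~~ P j.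
  by apply/negP => /imax ji'; case/eqP: ij; apply/val_inj/eqP; rewrite eqn_leq ji.
by rewrite /P negb_or negbK => /andP[_ /asboolP].
Qed.

(* The class of [\bot] in [L i], for [i > 0], is glued to a class of [L i.-1]
   and is sent to the number [i]; every other class spans a class of the sum;
   the extra point is sent to [0]. *)
Lemma quot_bigcsum_card theta : ConF theta ->
  dunion (quot (bigcsum theta)) `I_n.+1 #=
    dunion (bigdunion (fun i => quot (theta i))) `I_1.
Proof.
move=> ct; have cb := con_bigcsum ct.
pose f (u : {i & set (L i)} + nat) : set (bigosum L) + nat :=
  match u with
  | inl p => if `[< tag p <> ord0 /\ tagged p \bot%O >] then inr (tag p : nat)
    else inl [set q | exists2 x, tagged p x & bigcsum theta (biginj x, q)]
  | inr _ => inr 0%N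
  end.
have fE i x : f (inl (Tagged (fun i => set (L i)) (cclass (theta i) x))) =
    if `[< i <> ord0 /\ theta i (x, \bot%O) >] then inr (i : nat)
    else inl (cclass (bigcsum theta) (biginj x)).
  by rewrite -cclass_biginj.
have domE u : dunion (bigdunion (fun i => quot (theta i))) `I_1 u ->
    (exists i (x : L i), u = inl (Tagged (fun i => set (L i)) (cclass (theta i) x)))
    \/ u = inr 0%N.
  by move=> [[[i C] [x _ /= <-] <-]|[[|//] _ <-]]; [left; exists i, x|right].
have bimage : f @` dunion (bigdunion (fun i => quot (theta i))) `I_1 =
    dunion (quot (bigcsum theta)) `I_n.+1.
  apply/seteqP; split.
    move=> _ [_ /domE[[i [x ->]]|->] <-]; last by right; exists 0%N.
    rewrite fE; case: asboolP => _; first by right; exists i => //=.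
    by left; eexists => //; exists (biginj x).
  move=> _ [[_ [q _ <-] <-]|[m /= mn <-]]; last first.
    case: m mn => [_|m mn]; first by exists (inr 0%N) => //; right; exists 0%N.
    exists (inl (Tagged (fun i => set (L i)) (cclass (theta (Ordinal mn)) \bot%O))).
      by left; eexists => //; exists \bot%O.
    rewrite fE; case: asboolP => // -[]; split=> //; exact: con_refl.
  have [i [x [xq nb]]] := bigcsum_decomp q ct.
  exists (inl (Tagged (fun i => set (L i)) (cclass (theta i) x))).
    by left; eexists => //; exists x.
  rewrite fE; case: asboolP => [[i0 xb]|_].
    by case: nb => // -[]; exact: (con_sym (ct i)).
  by congr inl; apply/cclass_eqP.
apply: card_esym; rewrite -bimage; apply/card_esym/inj_card_eq.
(* A relation across two summands puts the higher element in the class of [\bot], which [f] sends to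
   a number. *)
have neq (i j : 'I_n.+1) x y : ~ (j <> ord0 /\ theta j (y, \bot%O)) ->
    bigcsum theta (@biginj i x, @biginj j y) -> ~ (i < j)%N.
  move=> nb xy ij; apply: nb; split; first by move=> j0; rewrite j0 in ij.
  by apply: con_sym => //; exact: bigcsum_inj_lt xy.
move=> u v /set_mem/domE[[i [x ->]]|->] /set_mem/domE[[j [y ->]]|->] //.
- rewrite !fE; case: asboolP => hx; case: asboolP => hy // -[].
    move=> /val_inj e; case: _ / e in y hy *.
    congr (inl (Tagged (fun i => set (L i)) _)).
    apply/cclass_eqP => //; apply: (con_trans (ct i) hx.2).
    exact: (con_sym (ct i) hy.2).
  move=> /(cclass_eqP _ _ cb) xy.
  have e : i = j.
    apply: ord_inj; apply/eqP; rewrite eqn_leq (leqNgt i) (leqNgt j); apply/andP.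
    split; apply/negP; last exact: (neq _ _ _ _ hy xy).
    exact: (neq _ _ _ _ hx (con_sym cb xy)).
  case: _ / e in y hy xy *; congr (inl (Tagged (fun i => set (L i)) _)).
  by apply/cclass_eqP => //; exact/bigcsum_inj.
- rewrite fE; case: asboolP => // -[i0 _] [] /= e.
  by case: i0; exact: val_inj.
- rewrite fE; case: asboolP => // -[j0 _] [] /= e.
  by case: j0; exact: val_inj.
Qed.

End BigOrdinalSum.

(** * Finite cardinals of disjoint unions *)

Lemma dunion_card_II T (A : set T) a b : A #= `I_a -> dunion A `I_b #= `I_(a + b).
Proof.
move=> /card_set_bijP[g [gfun ginj gsurj]]; apply/card_set_bijP.
exists (fun u => match u with inl x => g x | inr m => (a + m)%N end); split.
- move=> _ [[x Ax <-]|[m /= mb <-]] /=; last by rewrite ltn_add2l.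
  exact: leq_trans (gfun _ Ax) (leq_addr _ _).
- have ga x m : A x -> g x <> (a + m)%N.
    by move=> /gfun /= + e; rewrite e ltnNge leq_addr.
  move=> _ _ /set_mem[[x Ax <-]|[m mb <-]] /set_mem[[y Ay <-]|[k kb <-]].
  + by move=> /ginj -> //; exact/mem_set.
  + by move=> /(ga _ _ Ax).
  + by move=> /esym/(ga _ _ Ay).
  + by move=> /addnI ->.
- move=> m /= mab; have [ma|am] := ltnP m a.
    by have [x Ax <-] := gsurj m ma; exists (inl x) => //; left; exists x.
  exists (inr (m - a)%N); last by rewrite subnKC.
  by right; exists (m - a)%N => //=; rewrite ltn_subLR.
Qed.

(** The numberings of the [A i] lead into the finite type of pairs [S], whose enumeration supplies
    the final numbering. *)
Lemma bigdunion_card_II n (T : 'I_n -> Type) (A : forall i, set (T i))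
    (k : 'I_n -> nat) : (forall i, A i #= `I_(k i)) ->
  bigdunion A #= `I_(\sum_(i < n) k i).
Proof.
move=> Ak.
have {Ak}[g gP] : exists g : forall i, T i -> nat,
    forall i, set_bij (A i) `I_(k i) (g i).
  have gex i : exists g : T i -> nat, set_bij (A i) `I_(k i) g.
    exact/card_set_bijP.
  by exists (fun i => sval (cid (gex i))) => i; case: cid.
pose S : finType := {i : 'I_n & 'I_(k i)}.
have cS : #|S| = (\sum_(i < n) k i)%N.
  rewrite card_tagged sumnE big_map big_enum /=.
  by apply: eq_bigr => i _; rewrite card_ord.
rewrite -cS; apply/card_set_bijP.
(* The default [0] is taken only where [insub] fails, hence never on the union. *)
exists (fun u : {i & T i} =>
  if (insub (g (tag u) (tagged u)) : option 'I_(k (tag u))) is Some o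
  then enum_rank (Tagged (fun i => 'I_(k i)) o : S) : nat else 0%N).
have insE i x : A i x -> exists2 o : 'I_(k i),
    insub (g i x) = Some o & o = g i x :> nat.
  move=> Ax; have lt : (g i x < k i)%N by have [gf _ _] := gP i; exact: gf.
  by exists (Ordinal lt) => //; rewrite insubT.
split.
- by move=> [i x] /insE[o /= -> _]; exact: ltn_ord.
- move=> [i x] [j y] /set_mem Ax /set_mem Ay /=.
  have [o -> ox] := insE _ _ Ax; have [o' -> oy] := insE _ _ Ay.
  move=> /val_inj/enum_rank_inj e.
  have eij : i = j := congr1 tag e.
  case: _ / eij in y o' oy Ay e *.
  have eo : o = o' by apply/eqP; move/eqP: e; rewrite eq_Tagged.
  have [_ gi _] := gP i; congr Tagged; apply: gi; try exact/mem_set.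
  by rewrite -ox -oy eo.
- move=> m /= mS; set s := enum_val (Ordinal mS).
  have [_ _ gs] := gP (tag s); have [x Ax gx] := gs _ (ltn_ord (tagged s)).
  exists (Tagged T x) => //=; rewrite gx valK.
  have -> : Tagged (fun i => 'I_(k i)) (tagged s) = s by case: (s).
  by rewrite /s enum_valK.
Qed.

Lemma quot_bigcsum_card_II (d : Order.disp_t) n (L : 'I_n.+1 -> tbLatticeType d)
    (theta : forall i, set (L i * L i)) (k : 'I_n.+1 -> nat) :
  (forall i, Con (L i) (theta i)) -> (forall i, quot (theta i) #= `I_(k i)) ->
  quot (bigcsum theta) #= `I_((\sum_(i < n.+1) k i) - n.+1 + 1).
Proof.
move=> ct hk; set Q := quot _; set s := (\sum_(i < _) _)%N.
have QI : dunion Q `I_n.+1 #= `I_(s + 1).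
  apply: card_eq_trans (quot_bigcsum_card ct) _.
  exact/dunion_card_II/bigdunion_card_II.
(* [Q] embeds by [inl] in a finite disjoint union. *)
have [q Qq] : finite_set Q.
  have [||q hq] := @sub_finite_set _ (inl @` Q) (dunion Q `I_n.+1).
  - by move=> x; left.
  - by exists (s + 1)%N.
  - exists q; apply: card_eq_trans hq; apply/card_esym/inj_card_eq.
    by move=> x y _ _ [].
have /card_eq_II eqs : `I_(q + n.+1) #= `I_(s + 1).
  by apply: card_eq_trans QI; apply/card_esym/dunion_card_II.
(* With [q + n.+1 = s + 1], a positive [q] gives [n.+1 <= s], so the truncated subtraction is
   exact. *)
have q0 : (0 < q)%N.
  rewrite lt0n; apply/eqP => q0; rewrite q0 II0 in Qq.
  have : Q (cclass (bigcsum theta) \bot%O) by exists \bot%O.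
  by move: Qq; rewrite card_eq0 => /eqP ->.
have -> : (s - n.+1 + 1 = q)%N by lia.
exact: Qq.
Qed.

Theorem proposition5p9 (d : Order.disp_t) (n : nat)
    (L : 'I_n.+1 -> tbLatticeType d) :
  (* (1) *)
  (Con (bigosum L) =
     [set bigcsum theta | theta in [set theta : forall i, set (L i * L i) |
                                      forall i, Con (L i) (theta i)]] /\
   order_iso (Con (bigosum L)) (fun alpha beta => alpha `<=` beta)
     [set theta : forall i, set (L i * L i) | forall i, Con (L i) (theta i)]
     (fun theta phi => forall i, theta i `<=` phi i)) /\
  (* (2), as |L/theta| + n.+1 = \sum_i |L_i/theta_i| + 1 for arbitrary
     cardinals, and literally when the |L_i/theta_i| are finite *)
  (forall theta : forall i, set (L i * L i),
     (forall i, Con (L i) (theta i)) ->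
     dunion (quot (bigcsum theta)) `I_n.+1 #=
       dunion (bigdunion (fun i => quot (theta i))) `I_1 /\
     forall k : 'I_n.+1 -> nat,
       (forall i, quot (theta i) #= `I_(k i)) ->
       quot (bigcsum theta) #= `I_((\sum_(i < n.+1) k i) - n.+1 + 1)) /\
  (* (3) *)
  Con2 (bigosum L) =
    \bigcup_(i in [set: 'I_n.+1]) [set csum_at t | t in Con2 (L i)] /\
  (* (4) *)
  (Max (bigosum L) =
     \bigcup_(i in [set: 'I_n.+1]) [set csum_at t | t in Max (L i)] /\
   (Max (bigosum L) = Con2 (bigosum L) <->
      forall i, Max (L i) = Con2 (L i))) /\
  (* (5) *)
  (Spec (bigosum L) =
     \bigcup_(i in [set: 'I_n.+1]) [set csum_at t | t in Spec (L i)] /\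
   (Spec (bigosum L) = Con2 (bigosum L) <->
      forall i, Spec (L i) = Con2 (L i)) /\
   (Spec (bigosum L) = Max (bigosum L) <->
      forall i, Spec (L i) = Max (L i))).
Proof.
(* Properness of the members of all three sets lets [bigcup_csum_at_eq] turn equality of unions into
   equality at each position. *)
have max_np i : Max (L i) `<=` Con (L i) `\ nabla (L i) by move=> t [].
have spec_np i : Spec (L i) `<=` Con (L i) `\ nabla (L i) by move=> t [].
have con2_np i : Con2 (L i) `<=` Con (L i) `\ nabla (L i).
  by move=> t /max_con2 [].
split; first by split; [exact: con_bigcsum_image|exact: con_bigosum_iso].
split.
  move=> theta ct; split=> [|k]; first exact: quot_bigcsum_card.
  exact: quot_bigcsum_card_II.
by rewrite con2_bigosum max_bigosum spec_bigosum !bigcup_csum_at_eq//.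
Qed.
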